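(* Let $r>0$ be a real number. The following two assertions are equivalent: (i) for every real random vector $(X,Y)$ that satisfies either the discrete model or the density model (both defined in the context) and has $\mathbb{E}|X|^{r}<\infty$, one has $$\mathbb{E}|X+Y|^{r}\ \ge\ \mathbb{E}|X-Y|^{r};$$ (ii) $0<r\le 2$.
   Context: Discrete model. Let $I=\{1,\ldots,n\}$ for some positive integer $n$, or $I=\mathbb{N}$. Let $(a_i)_{i\in I}$ be pairwise distinct real numbers. Let $(p_{ij})_{i,j\in I}$ be a real array that is symmetric ($p_{ij}=p_{ji}$), satisfies $p_{ij}\ge 0$ for all $i,j\in I$ and $\sum_{i\in I}\sum_{j\in I}p_{ij}=1$, and is non-negative in the quadratic-form sense: for every finite set $F\subseteq I$ and every real family $(u_i)_{i\in F}$, $$\sum_{i\in F}\sum_{j\in F}u_iu_jp_{ij}\ge 0.$$ The random vector $(X,Y)$ satisfies the discrete model if, for some such data, $\mathbb{P}(X=a_i,Y=a_j)=p_{ij}$ for all $i,j\in I$. Density model. Let $D\subseteq\mathbb{R}$ be a Borel set and let $f:D^2\to[0,\infty)$ be measurable and symmetric ($f(x,y)=f(y,x)$) with $\iint_{D^2}f(x,y)\,\mathrm{d}x\,\mathrm{d}y=1$. Assume that $f$ is non-negative in the integral quadratic-form sense: for every measurable $\delta:D\to\mathbb{R}$ with $\iint_{D^2}|\delta(x)\delta(y)|f(x,y)\,\mathrm{d}x\,\mathrm{d}y<\infty$, one has $$\iint_{D^2}\delta(x)\delta(y)f(x,y)\,\mathrm{d}x\,\mathrm{d}y\ge 0.$$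 The random vector $(X,Y)$ satisfies the density model if, for some such $D$ and $f$, it has joint density $f$ on $D^2$, i.e. $\mathbb{P}((X,Y)\in B)=\iint_B f(x,y)\,\mathrm{d}x\,\mathrm{d}y$ for every Borel set $B\subseteq D^2$. *)

(* Defs.v *)
From HB Require Import structures.
From mathcomp Require Export all_boot all_order all_algebra.
From mathcomp Require Export finmap measurable_realfun.
From mathcomp Require Export all_classical all_reals all_analysis.

Set Implicit Arguments.
Unset Strict Implicit.
Unset Printing Implicit Defensive.

Import Order.TTheory GRing.Theory Num.Theory.
Import numFieldNormedType.Exports.

Local Open Scope classical_set_scope.
Local Open Scope ring_scope.

Section Models.
Context {R : realType}.

(* {1, ..., n} with n positive is relabelled as {0, ..., n - 1} = `I_n;
   the values of a and p at indices outside I play no role below. *)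
Definition index_set (I : set nat) : Prop :=
  (exists2 n : nat, (0 < n)%N & I = `I_n) \/ I = [set: nat].

Definition nonneg_definite_array (I : set nat) (p : nat -> nat -> R) : Prop :=
  forall (F : {fset nat}) (u : nat -> R), [set` F] `<=` I ->
    0 <= \sum_(i <- F) \sum_(j <- F) u i * u j * p i j.

Record discrete_data (I : set nat) (a : nat -> R) (p : nat -> nat -> R) :
    Prop := {
  discrete_index : index_set I;
  discrete_distinct : forall i j, I i -> I j -> a i = a j -> i = j;
  discrete_sym : forall i j, I i -> I j -> p i j = p j i;
  discrete_ge0 : forall i j, I i -> I j -> 0 <= p i j;
  discrete_sum1 : (\esum_(i in I) \esum_(j in I) (p i j)%:E = 1)%E;
  discrete_psd : nonneg_definite_array I p }.

Definition discrete_model (d : measure_display) (T : measurableType d)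
    (P : probability T R) (X Y : {RV P >-> R}) : Prop :=
  exists (I : set nat) (a : nat -> R) (p : nat -> nat -> R),
    discrete_data I a p /\
    forall i j, I i -> I j ->
      P [set w | X w = a i /\ Y w = a j] = (p i j)%:E.

(* measurableTypeR R is R with the same Borel sigma-algebra; lebesgue_measure
   lives on it. *)
Definition lebesgue_measure2 :
    set (measurableTypeR R * measurableTypeR R) -> \bar R :=
  (@lebesgue_measure R \x @lebesgue_measure R)%E.
HB.instance Definition _ := Measure.on lebesgue_measure2.

Definition nonneg_definite_kernel (D : set R) (f : R * R -> R) : Prop :=
  forall delta : R -> R, measurable_fun D delta ->
    (\int[lebesgue_measure2]_(z in D `*` D)
       (`|delta z.1 * delta z.2| * f z)%:E < +oo)%E ->
    (0 <= \int[lebesgue_measure2]_(z in D `*` D)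
            (delta z.1 * delta z.2 * f z)%:E)%E.

(* f is only meaningful on D `*` D: its values elsewhere are unconstrained
   and never used. *)
Record density_data (D : set R) (f : R * R -> R) : Prop := {
  density_dom : measurable D;
  density_meas : measurable_fun (D `*` D) f;
  density_ge0 : forall x y, D x -> D y -> 0 <= f (x, y);
  density_sym : forall x y, D x -> D y -> f (x, y) = f (y, x);
  density_int1 :
    (\int[lebesgue_measure2]_(z in D `*` D) (f z)%:E = 1)%E;
  density_psd : nonneg_definite_kernel D f }.

Definition density_model (d : measure_display) (T : measurableType d)
    (P : probability T R) (X Y : {RV P >-> R}) : Prop :=
  exists (D : set R) (f : R * R -> R),
    density_data D f /\
    forall B : set (R * R), measurable B -> B `<=` D `*` D ->
      P [set w | B (X w, Y w)] =
      (\int[lebesgue_measure2]_(z in B) (f z)%:E)%E.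

End Models.

Arguments discrete_model {R d T} P X Y.
Arguments density_model {R d T} P X Y.

(* Main.v *)
From HB Require Import structures.
Require Import Defs.
From mathcomp Require Import all_boot all_order all_algebra.
From mathcomp Require Import all_classical all_reals measurable_realfun all_analysis.
From mathcomp Require Import ring lra.

Import Order.TTheory GRing.Theory Num.Theory.
Import numFieldNormedType.Exports.

Local Open Scope classical_set_scope.
Local Open Scope ring_scope.

(** Both models say the same thing about bounded test functions: for every
bounded measurable [delta], E delta(X) delta(Y) >= 0
([discrete_bounded_ge0], [density_bounded_ge0]).  Only delta(x) = sin(xt) is
needed afterwards.  By the addition formula,
  cos((X - Y)t) - cos((X + Y)t) = 2 sin(Xt) sin(Yt),
hence E(1 - cos((X - Y)t)) <= E(1 - cos((X + Y)t)) for all t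
([expectation_oneBcos_le]).

For 0 < r < 2 the power |u|^r is a mixture of the functions 1 - cos(ut) with
positive weights: up to a constant it is the integral of
(1 - cos(ut)) t^(-r-1) over t > 0, which converges exactly for 0 < r < 2.
With t = e^s this becomes an integral over the whole line in which scaling u
is a translation of s ([integral_cos_kernel_scale]).  Tonelli's theorem then
gives the inequality for r.  For r = 2 the mixture degenerates to the limit
2 n^2 (1 - cos(u/n)) --> u^2, and Fatou's lemma replaces Tonelli's theorem.

For r > 2 take X and Y independent with common law supported by {1, -1/16}.
For independent variables E|X+Y|^r - E|X-Y|^r is a quadratic form in the
weights (s, t) at 1 and -b, with matrix entries 2^r, (2b)^r and off-diagonal
entry -K, where K = (1+b)^r - (1-b)^r.  It takes negative values at positive
weights as soon as K > 2^r b^(r/2), and minimizing leads to s/t = b^(r/2).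
Since K >= 4b for r >= 2, the choice b = 1/16 works: 2^r b^(r/2) = 2^(-r) < 1/4
([powR_gap], [counterexample]). *)

(** * Elementary facts on the cosine *)

Section Cosine.
Context {R : realType}.
Implicit Types u t : R.

Lemma le_sin_norm u : `|sin u| <= `|u|.
Proof.
wlog u0 : u / 0 <= u.
  move=> H; case: (leP 0 u) => [/H//|/ltW u0].
  by have := H (- u); rewrite sinN !normrN; apply; rewrite oppr_ge0.
have [->|un0] := eqVneq u 0; first by rewrite sin0 normr0.
have up : 0 < u by rewrite lt_def un0.
have [c _ hc] : exists2 c, c \in `]0, u[ & sin u - sin 0 = cos c * (u - 0).
  apply: (@MVT R sin cos) => //.
  by apply: continuous_subspaceT => x; exact: continuous_sin.
by move: hc; rewrite sin0 !subr0 => ->; rewrite normrM ler_piMl// cos_max.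
Qed.

Lemma oneBcosE u : 1 - cos u = 2 * sin (u / 2) ^+ 2.
Proof.
have := cos_mulr2n (u / 2); rewrite -[u / 2 *+ 2]mulr_natr divfK// => ->.
by rewrite sin2cos2; ring.
Qed.

Lemma oneBcos_ge0 u : 0 <= 1 - cos u.
Proof. by rewrite subr_ge0 cos_le1. Qed.

Lemma oneBcos_le2 u : 1 - cos u <= 2.
Proof. by have := cos_geN1 u; lra. Qed.

Lemma oneBcos_le u : 1 - cos u <= u ^+ 2 / 2.
Proof.
rewrite oneBcosE; have : sin (u / 2) ^+ 2 <= (u / 2) ^+ 2.
  by rewrite -[leLHS]real_normK ?num_real// -[leRHS]real_normK ?num_real//
    lerXn2r ?nnegrE// le_sin_norm.
by lra.
Qed.

(** Equivalent to cos''(0) = -1; it follows from sin'(0) = 1 through the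
    half-angle formula. *)
Lemma cvg_oneBcos u :
  n.+1%:R ^+ 2 * (1 - cos (u / n.+1%:R)) @[n --> \oo] --> u ^+ 2 / 2.
Proof.
have [->|u0] := eqVneq u 0.
  rewrite expr0n/= mul0r; apply: cvg_near_cst; apply: nearW => n.
  by rewrite mul0r cos0 subrr mulr0.
have dsin : (h^-1 * sin h) @[h --> 0^'] --> (1 : R).
  have [+ +] := @is_derive_sin R 0; rewrite cos0 => /cvg_ex[l hl].
  rewrite /derive (cvg_lim _ hl)// => <-.
  apply: cvg_trans hl; apply: near_eq_cvg; apply: nearW => h.
  by rewrite /= addr0 sin0 subr0 /GRing.scale/= mulr1.
(* for u != 0 the argument tends to 0 without reaching it, as the difference
   quotient of the sine requires *)
have hn : (u / 2 * n.+1%:R^-1) @[n --> \oo] --> (0 : R)^'.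
  move=> A hA.
  have h0 : (u / 2 * n.+1%:R^-1) @[n --> \oo] --> (0 : R).
    by rewrite -[X in _ --> X](mulr0 (u / 2)); apply: cvgMr; exact: cvg_harmonic.
  have h1 : \forall n \near \oo, u / 2 * n.+1%:R^-1 != 0 :> R ->
      A (u / 2 * n.+1%:R^-1) by exact: h0 _ hA.
  rewrite /nbhs/=; near=> n; apply: (near h1 n) => //.
  by rewrite !mulf_neq0 ?invr_neq0.
have hs := cvg_comp _ _ hn dsin.
have -> : u ^+ 2 / 2 = 2 * (u / 2) ^+ 2 * (1 * 1) :> R by field.
under eq_fun => n.
  have -> : n.+1%:R ^+ 2 * (1 - cos (u / n.+1%:R)) = 2 * (u / 2) ^+ 2 *
     (((u / 2 * n.+1%:R^-1)^-1 * sin (u / 2 * n.+1%:R^-1)) *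
     ((u / 2 * n.+1%:R^-1)^-1 * sin (u / 2 * n.+1%:R^-1))) :> R.
    have -> : u / 2 * n.+1%:R^-1 = u / n.+1%:R / 2 by rewrite mulrAC.
    rewrite oneBcosE; move: (sin _) => s.
    have : n.+1%:R != 0 :> R by rewrite pnatr_eq0.
    move: (n.+1%:R : R) => N N0.
    by field; rewrite u0 N0.
  over.
by apply: cvgMr; apply: cvgM.
Unshelve. all: end_near. Qed.

End Cosine.

(** * Bounded functions of a random vector *)

Section BoundedExpectation.
Context (R : realType) (d : measure_display) (T : measurableType d)
  (P : probability T R).
Local Open Scope ereal_scope.

(** The common consequence of the two models from which the moment inequality
    follows. *)
Definition bounded_nonneg_definite (X Y : T -> R) : Prop :=
  forall delta : R -> R, measurable_fun setT delta ->
    (forall x, (`|delta x| <= 1)%R) ->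
    0 <= \int[P]_w (delta (X w) * delta (Y w))%:E.

Lemma bounded_integrable (f : T -> R) (M : R) : measurable_fun setT f ->
  (forall w, (`|f w| <= M)%R) -> P.-integrable setT (EFin \o f).
Proof.
move=> mf fM; apply: measurable_bounded_integrable => //.
- by rewrite (le_lt_trans (probability_le1 _ _)) ?ltry.
- exists M; split; first exact: num_real.
  by move=> N MN w _ /=; rewrite (le_trans (fM w))// ltW.
Qed.

(** Adding 1 makes the integrand nonnegative, so that approximation arguments
    for nonnegative functions apply to a signed product. *)
Lemma integral_oneD (f : T -> R) : measurable_fun setT f ->
  (forall w, (`|f w| <= 1)%R) ->
  \int[P]_w (1 + f w)%:E = 1 + \int[P]_w (f w)%:E.
Proof.
move=> mf f1; under eq_integral do rewrite EFinD.
rewrite integralD_EFin//; last exact: bounded_integrable f1.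
  by congr (_ + _); rewrite integral_cst// mul1e; exact: probability_setT.
exact: finite_measure_integrable_cst.
Qed.

End BoundedExpectation.

(** * The discrete model *)

Section Discrete.
Context (R : realType).

Lemma sum_indic_le1 (F : {fset nat}) (a : nat -> R) (x : R) :
  {in F &, injective a} -> \sum_(i <- F) (x == a i)%:R <= 1 :> R.
Proof.
move=> ainj; have [/existsP[i /eqP xi]|none] := boolP [exists i : F, x == a (val i)].
  rewrite (big_fsetD1 (val i)) ?fsvalP//= xi eqxx big1_fset ?addr0// => j.
  rewrite !inE => /andP[ji jF] _; case: eqP => // /ainj.
  by move=> /(_ (fsvalP i) jF) ij; move: ji; rewrite ij eqxx.
rewrite big1_fset// => j jF _; case: eqP => // xj; case/existsP: none.
by exists [` jF]%fset; apply/eqP.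
Qed.

Local Open Scope ereal_scope.

(** A square block F x F, rather than an arbitrary finite set of pairs, is needed
    because the quadratic-form condition is about such blocks. *)
Lemma discrete_mass (I : set nat) (p : nat -> nat -> R) (e : R) :
  (forall i j, I i -> I j -> 0 <= p i j)%R ->
  \esum_(i in I) \esum_(j in I) (p i j)%:E = 1 -> (0 < e)%R ->
  exists2 F : {fset nat}, [set` F] `<=` I &
    (1 - e <= \sum_(i <- F) \sum_(j <- F) p i j)%R.
Proof.
move=> p0 p1 e0.
rewrite (@esum_esum _ _ _ I (fun=> I) (fun i j => (p i j)%:E)) in p1; last first.
  by move=> i j Ii Ij; rewrite lee_fin p0.
have : (1 - e)%:E < ereal_sup [set \sum_(x \in A) (p x.1 x.2)%:E | A in fsets (I `*`` (fun=> I))].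
  by rewrite -[X in _ < X]/(esum _ _) p1 lte_fin ltrBlDr ltrDl.
move=> /ereal_sup_gt[_ [S [finS SI] <-] Se].
have finF : finite_set (fst @` S `|` snd @` S).
  by rewrite finite_setU; split; exact: finite_image.
have FI : [set` fset_set (fst @` S `|` snd @` S)] `<=` I.
  by rewrite fset_setK// => _ [|] [x /SI[/= ? ?] <-].
exists (fset_set (fst @` S `|` snd @` S)) => //.
set F := fset_set _ in FI *.
rewrite -lee_fin; apply/ltW/(lt_le_trans Se).
have -> : (\sum_(i <- F) \sum_(j <- F) p i j)%:E =
    \esum_(i in [set` F]) \esum_(j in [set` F]) (p i j)%:E.
  have E i : i \in F ->
      \esum_(j in [set` F]) (p i j)%:E = (\sum_(j <- F) p i j)%:E.
    move=> iF; rewrite esum_fset//; last first.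
      by move=> j /[!inE] jF; rewrite lee_fin p0//; exact: FI.
    by rewrite fsbig_finite//= set_fsetK sumEFin.
  rewrite esum_fset//; last first.
    move=> i /[!inE] iF; rewrite E// lee_fin big_seq sumr_ge0// => j jF.
    by rewrite p0//; exact: FI.
  rewrite fsbig_finite//= set_fsetK -sumEFin big_seq [RHS]big_seq.
  by apply: eq_bigr => i iF; rewrite E.
rewrite (@esum_esum _ _ _ _ (fun=> [set` F]) (fun i j => (p i j)%:E)); last first.
  by move=> i j iF jF; rewrite lee_fin p0//; exact: FI.
apply: esum_ge; exists S => //; split => // x Sx.
by split; rewrite /= /F in_fset_set//; apply/mem_set; [left|right]; exists x.
Qed.

(** On a finite block of atoms carrying mass at least 1 - e the expectation is a
    nonnegative finite quadratic form; elsewhere 1 + delta(X) delta(Y) is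
    nonnegative, so E(1 + delta(X) delta(Y)) >= 1 - e. *)
Lemma discrete_bounded_ge0 (d : measure_display) (T : measurableType d)
    (P : probability T R) (X Y : {RV P >-> R}) :
  discrete_model P X Y -> bounded_nonneg_definite R d T P X Y.
Proof.
move=> [I [a [p [[_ ainj _ p0 p1 psd] PE]]]] delta mdelta delta1.
pose dd w : R := (delta (X w) * delta (Y w))%R.
have mdd : measurable_fun setT dd.
  by apply: measurable_funM; apply: measurableT_comp.
have dd1 w : (`|dd w| <= 1)%R by rewrite normrM mulr_ile1.
have dd0 w : (0 <= 1 + dd w)%R by have := dd1 w; rewrite ler_norml; lra.
rewrite -(@leeD2lE _ 1)// -integral_oneD// adde0; apply/lee_addgt0Pr => e e0.
have [F FI Fe] := discrete_mass I p e p0 p1 e0.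
rewrite -leeBlDr//.
pose A i j : set T := X @^-1` [set a i] `&` Y @^-1` [set a j].
have mA i j : measurable (A i j).
  by apply: measurableI; exact: measurable_funPTI.
have A01 w i j : \1_(A i j) w = ((X w == a i)%:R * (Y w == a j)%:R)%R :> R.
  rewrite indicE -natrM mulnb; congr ((nat_of_bool _)%:R).
  by apply/idP/andP => [/[!inE] -[/= -> ->]//|[/eqP ? /eqP ?]]; rewrite inE.
have c0 i j : (0 <= 1 + delta (a i) * delta (a j))%R.
  have : (`|delta (a i) * delta (a j)| <= 1)%R by rewrite normrM mulr_ile1.
  by rewrite ler_norml; lra.
have mcA i j : measurable_fun setT
    (fun w => ((1 + delta (a i) * delta (a j)) * \1_(A i j) w)%:E).
  by apply/measurable_EFinP; exact: measurable_funM.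
have step : \int[P]_w (\sum_(i <- F) \sum_(j <- F)
    ((1 + delta (a i) * delta (a j)) * \1_(A i j) w)%:E) <= \int[P]_w (1 + dd w)%:E.
  apply: ge0_le_integral => //.
  - by move=> w _; do 2 (apply: sume_ge0 => ? _); rewrite lee_fin mulr_ge0// c0.
  - by do 2 (apply: emeasurable_sum => ?); exact: mcA.
  - by apply/measurable_EFinP; exact: measurable_funD.
  - move=> w _; under eq_bigr do rewrite sumEFin.
    rewrite sumEFin lee_fin.
    (* delta (a i) equals delta (X w) wherever the indicator of X w = a i
       does not vanish, so the double sum factors *)
    have -> : (\sum_(i <- F) \sum_(j <- F)
          (1 + delta (a i) * delta (a j)) * \1_(A i j) w =
        (1 + dd w) * ((\sum_(i <- F) (X w == a i)%:R) *
                      (\sum_(j <- F) (Y w == a j)%:R)))%R.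
      rewrite big_distrlr/= mulr_sumr; apply: eq_bigr => i _.
      rewrite mulr_sumr; apply: eq_bigr => j _; rewrite A01.
      by case: eqP => [<-|_]; case: eqP => [<-|_]; rewrite ?(mul0r, mulr0).
    rewrite ler_piMr// mulr_ile1//; try by apply: sumr_ge0.
      by apply: sum_indic_le1 => i j iF jF; apply: ainj; exact: FI.
    by apply: sum_indic_le1 => i j iF jF; apply: ainj; exact: FI.
apply: le_trans step.
rewrite ge0_integral_sum//; last 2 first.
- by move=> i; apply: emeasurable_sum => j; exact: mcA.
- by move=> i w _; apply: sume_ge0 => j _; rewrite lee_fin mulr_ge0// c0.
under eq_bigr => i _.
  rewrite ge0_integral_sum//; last first.
    by move=> j w _; rewrite lee_fin mulr_ge0// c0.
  over.
have -> : \sum_(i <- F) \sum_(j <- F) \int[P]_w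
      ((1 + delta (a i) * delta (a j)) * \1_(A i j) w)%:E =
    (\sum_(i <- F) \sum_(j <- F) p i j + \sum_(i <- F) \sum_(j <- F)
      delta (a i) * delta (a j) * p i j)%:E.
  rewrite -big_split/= -sumEFin big_seq [RHS]big_seq; apply: eq_bigr => i iF.
  rewrite -big_split/= -sumEFin big_seq [RHS]big_seq; apply: eq_bigr => j jF.
  under eq_integral do rewrite EFinM.
  rewrite ge0_integralZl ?lee_fin//; last first.
    exact/measurable_EFinP/measurable_indic.
  rewrite integral_indic// setIT [X in _ * X](_ : _ = (p i j)%:E); last first.
    by apply: PE; exact: FI.
  by rewrite -EFinM mulrDl mul1r.
rewrite -EFinB lee_fin (le_trans Fe)// lerDl.
exact: (psd F (delta \o a)).
Qed.

End Discrete.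

(** * The density model *)

Section IntegralDensity.
Context d (T : measurableType d) (R : realType).
Local Open Scope ereal_scope.
Import HBNNSimple.

(** Integration against a measure with density [F], by approximation of [g] by
    simple functions. *)
Lemma integral_density (mu Q : {measure set T -> \bar R}) (F : T -> R)
    (g : T -> R) :
  measurable_fun setT F -> (forall x, 0 <= F x)%R ->
  (forall A, measurable A -> Q A = \int[mu]_(x in A) (F x)%:E) ->
  measurable_fun setT g -> (forall x, 0 <= g x)%R ->
  \int[Q]_x (g x)%:E = \int[mu]_x (g x * F x)%:E.
Proof.
move=> mF F0 QE mg g0.
have mg' : measurable_fun setT (EFin \o g) by exact/measurable_EFinP.
pose h := nnsfun_approx measurableT mg'.
have cvgh x : (h n x)%:E @[n --> \oo] --> (g x)%:E.
  by apply: (@cvg_nnsfun_approx _ _ _ _ measurableT _ mg') => // y _; rewrite lee_fin.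
have ndh x m n : (m <= n)%N -> (h m x <= h n x)%R.
  by move=> mn; exact/lefP/nd_nnsfun_approx.
have -> : \int[Q]_x (g x)%:E = limn (fun n => \int[Q]_x (h n x)%:E).
  rewrite -monotone_convergence//.
  - by apply: eq_integral => x _; apply/esym/cvg_lim.
  - by move=> n; exact/measurable_EFinP.
  - by move=> n x _; rewrite lee_fin.
  - by move=> x _ m n mn; rewrite lee_fin ndh.
have -> : \int[mu]_x (g x * F x)%:E = limn (fun n => \int[mu]_x (h n x * F x)%:E).
  rewrite -monotone_convergence//.
  - apply: eq_integral => x _; apply/esym/cvg_lim => //.
    by rewrite EFinM; under eq_fun do rewrite EFinM; apply: cvgeZr.
  - by move=> n; apply/measurable_EFinP; exact: measurable_funM.
  - by move=> n x _; rewrite lee_fin mulr_ge0.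
  - by move=> x _ m n mn; rewrite lee_fin ler_wpM2r// ndh.
congr (limn _); apply/funext => n.
have mind r : measurable_fun setT (\1_(h n @^-1` [set r]) : T -> R).
  exact/measurable_indic.
under eq_integral do rewrite fimfunE -fsumEFin//.
under [RHS]eq_integral => x _.
  rewrite EFinM fimfunE -fsumEFin// ge0_mule_fsuml; last first.
    by move=> r; exact: nnfun_muleindic_ge0.
  over.
rewrite !ge0_integral_fsum//; last 4 first.
- move=> r; apply/emeasurable_funM; apply/measurable_EFinP => //.
  exact: measurable_funM.
- by move=> r x _; apply: mule_ge0; rewrite ?lee_fin//; exact: nnfun_muleindic_ge0.
- by move=> r; apply/measurable_EFinP; exact: measurable_funM.
- by move=> r x _; exact: nnfun_muleindic_ge0.
apply: eq_fsbigr => r /[!inE] -[t _ <-].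
have r0 : (0 <= h n t)%R by [].
under eq_integral do rewrite EFinM.
under [RHS]eq_integral do rewrite EFinM -muleA.
rewrite !ge0_integralZl//.
- rewrite integral_indic// setIT QE//.
  rewrite [in LHS]integral_mkcond/=; congr (_ * _).
  apply: eq_integral => x _; rewrite patchE indicE.
  by case: ifPn => _; rewrite ?mul1e ?mul0e.
- by apply/emeasurable_funM; apply/measurable_EFinP.
- by move=> x _; apply: mule_ge0; rewrite lee_fin.
- exact/measurable_EFinP.
Qed.

End IntegralDensity.

Section Density.
Local Open Scope ereal_scope.

(** Boundedness makes delta(x) delta(y) integrable against f, so the integral
    form of the condition applies; the law of (X, Y) has density f on D x D and
    no mass outside. *)
Lemma density_bounded_ge0 (R : realType) (d : measure_display)
    (T : measurableType d) (P : probability T R) (X Y : {RV P >-> R}) :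
  density_model P X Y -> bounded_nonneg_definite R d T P X Y.
Proof.
move=> [D [f [[mD mf f0 _ f1 psd] PE]]] delta mdelta delta1.
pose Z w : measurableTypeR R * measurableTypeR R := (X w, Y w).
have mZ : measurable_fun setT Z.
  by apply: measurable_fun_pair; [exact: (measurable_funP X)|exact: (measurable_funP Y)].
pose Zm : {mfun T >-> (measurableTypeR R * measurableTypeR R)%type} :=
  HB.pack Z (isMeasurableFun.Build _ _ _ _ Z mZ).
pose dd (z : measurableTypeR R * measurableTypeR R) : R := (delta z.1 * delta z.2)%R.
have mdd : measurable_fun setT dd.
  by apply: measurable_funM; apply: measurableT_comp.
have dd1 z : (`|dd z| <= 1)%R by rewrite normrM mulr_ile1.
have f0' z : D z.1 -> D z.2 -> (0 <= f z)%R by case: z => x y; exact: f0.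
have mDD : measurable (D `*` D : set (measurableTypeR R * measurableTypeR R)) by exact: measurableX.
pose F : measurableTypeR R * measurableTypeR R -> R := (f \_ (D `*` D))%R.
have mF : measurable_fun setT F by exact/(measurable_restrictT _ _).1.
have F0 z : (0 <= F z)%R.
  rewrite /F patchE; case: ifPn => // /[!inE] -[]; exact: f0'.
pose Q : probability (measurableTypeR R * measurableTypeR R)%type R := distribution P Zm.
(* F is 0 off D x D and Q has no mass there, so only the part of A inside
   D x D matters *)
have QE A : measurable A -> Q A = \int[lebesgue_measure2]_(z in A) (F z)%:E.
  move=> mA.
  have QD : Q (~` (D `*` D)) = 0.
    have QD1 : Q (D `*` D) = 1.
      by rewrite -f1; exact: (PE _ mDD).
    by rewrite probability_setC// QD1 subee.
  transitivity (Q (A `\` D `*` D) + Q (A `&` (D `*` D))); first exact: measureDI.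
  have -> : Q (A `\` D `*` D) = 0.
    apply: (subset_measure0 _ _ _ QD) => //; first exact: measurableD.
    exact: measurableC.
  have -> : Q (A `&` (D `*` D)) =
      \int[lebesgue_measure2]_(z in A `&` D `*` D) (f z)%:E.
    by apply: PE; [exact: measurableI|move=> z []].
  rewrite add0e integral_mkcondr; apply: eq_integral => z _.
  by rewrite /F !patchE; case: ifP.
have fi : lebesgue_measure2.-integrable (D `*` D) (EFin \o f).
  apply/integrableP; split; first exact/measurable_EFinP.
  under eq_integral => z zD.
    rewrite /= ger0_norm; last first.
      by move: zD; rewrite inE => -[]; exact: f0'.
    over.
  by rewrite f1 ltry.
have ddb (S : set (measurableTypeR R * measurableTypeR R)) : [bounded dd x | x in S].
  by exists 1%R; split=> // M M1 z _ /=; rewrite (le_trans (dd1 z))// ltW.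
have ddf : lebesgue_measure2.-integrable (D `*` D) (fun z => (dd z * f z)%:E).
  have := integrableMr mDD (measurable_funTS mdd) (ddb _) fi.
  by apply: eq_integrable.
have dge0 : 0 <= \int[lebesgue_measure2]_(z in D `*` D) (dd z * f z)%:E.
  apply: psd; first exact: measurable_funTS.
  case/integrableP: ddf => _; congr (_ < _); apply: eq_integral => z.
  rewrite inE => -[Dx Dy]; rewrite /= normrM (@ger0_norm _ (f z))//.
  exact: f0'.
have PI : \int[P]_w (1 + dd (Z w))%:E = 1 + \int[P]_w (dd (Z w))%:E.
  by rewrite integral_oneD//; exact: measurableT_comp.
have DI : \int[lebesgue_measure2]_(z in D `*` D) ((1 + dd z) * f z)%:E =
    1 + \int[lebesgue_measure2]_(z in D `*` D) (dd z * f z)%:E.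
  under eq_integral do rewrite mulrDl mul1r EFinD.
  by rewrite integralD_EFin// f1.
have dd0 z : (0 <= 1 + dd z)%R by have := dd1 z; rewrite ler_norml; lra.
have m1dd : measurable_fun setT (fun z => 1 + dd z)%R by exact: measurable_funD.
have : \int[P]_w (1 + dd (Z w))%:E =
    \int[lebesgue_measure2]_(z in D `*` D) ((1 + dd z) * f z)%:E.
  transitivity (\int[Q]_z (1 + dd z)%:E).
    by rewrite ge0_integral_distribution//; exact/measurable_EFinP.
  rewrite (@integral_density _ _ _ lebesgue_measure2 Q F _ mF F0 QE m1dd dd0) [RHS]integral_mkcond.
  apply: eq_integral => z _; rewrite /F !patchE.
  by case: ifP; rewrite ?mulr0.
rewrite PI DI => H.
by rewrite -(@leeD2lE _ 1)// H adde0 leeDl.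
Qed.

End Density.

(** * The power as a mixture of cosines *)

Section Kernel.
Context {R : realType}.
Local Notation leb := (@lebesgue_measure R).
Implicit Types r u s : R.

(** The integrand (1 - cos(ut)) t^(-r-1) dt after the substitution t = e^s. *)
Definition cos_kernel r u s : R := (1 - cos (u * expR s)) * expR (- r * s).

Lemma cos_kernel_ge0 r u s : 0 <= cos_kernel r u s.
Proof. by rewrite mulr_ge0 ?expR_ge0 ?oneBcos_ge0. Qed.

Lemma continuous_cos_kernel r u : continuous (cos_kernel r u).
Proof.
move=> s; apply: cvgM; last first.
  apply: (@continuous_comp _ _ _ (fun x => - r * x) expR); last exact: continuous_expR.
  by apply: cvgMr; exact: cvg_id.
apply: cvgB; first exact: cvg_cst.
apply: (@continuous_comp _ _ _ (fun x => u * expR x) cos); last exact: continuous_cos.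
by apply: cvgMr; exact: continuous_expR.
Qed.

Lemma measurable_cos_kernel r u : measurable_fun setT (cos_kernel r u).
Proof. by apply: continuous_measurable_fun; exact: continuous_cos_kernel. Qed.

Local Open Scope ereal_scope.

Lemma integral_shift (G : R -> R) (v : R) : continuous G -> (forall x, 0 <= G x)%R ->
  \int[leb]_s (G s)%:E = \int[leb]_s (G (s + v)%R)%:E.
Proof.
move=> cG G0.
have D1 : derive1 (fun s : R => s + v)%R = cst 1%R.
  by apply/funext => s; rewrite derive1E deriveD// derive_id derive_cst addr0.
rewrite (@increasing_ge0_integration_by_substitutionT _ (fun s => s + v)%R)//.
- by apply: eq_integral => s _; rewrite D1 /= mulr1.
- by move=> x y xy; rewrite ltrD2r.
- by rewrite D1; exact: cst_continuous.
- by rewrite D1; exact: is_cvg_cst.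
- by rewrite D1; exact: is_cvg_cst.
- apply/cvgrNyPle => A; near=> x; rewrite -lerBrDr; near: x.
  by apply: nbhs_ninfty_le; rewrite num_real.
- apply/cvgryPge => A; near=> x; rewrite -lerBlDr; near: x.
  by apply: nbhs_pinfty_ge; rewrite num_real.
Unshelve. all: end_near. Qed.

Lemma integral_reflect (f : R -> R) : measurable_fun setT f -> (forall x, 0 <= f x)%R ->
  \int[leb]_s (f (- s)%R)%:E = \int[leb]_s (f s)%:E.
Proof.
move=> mf f0.
transitivity (\int[pushforward leb (-%R : R -> measurableTypeR R)]_s (f s)%:E).
  rewrite ge0_integral_pushforward//.
  - exact/measurable_EFinP.
  - by move=> y _; rewrite lee_fin.
by apply: eq_measure_integral => A mA _; exact: lebesgue_measureN.
Qed.

(** Replacing u by 1 is the translation of s by ln|u|, which multiplies the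
    weight e^(-rs) by |u|^r. *)
Lemma integral_cos_kernel_scale r u : (0 < r)%R ->
  \int[leb]_s (cos_kernel r u s)%:E =
  (`|u| `^ r)%:E * \int[leb]_s (cos_kernel r 1 s)%:E.
Proof.
move=> r0; have [->|u0] := eqVneq u 0%R.
  rewrite normr0 powR0 ?gt_eqF// mul0e integral0_eq// => s _.
  by rewrite /cos_kernel mul0r cos0 subrr mul0r.
have nu0 : (0 < `|u|)%R by rewrite normr_gt0.
rewrite (@integral_shift _ (- ln `|u|)%R).
- rewrite -ge0_integralZl//.
  + apply: eq_integral => s _; rewrite -EFinM; congr EFin.
    rewrite /cos_kernel mul1r mulrCA; congr (_ * _)%R.
      rewrite -cos_norm normrM [X in (_ * X)%R]ger0_norm ?expR_ge0//.
      by rewrite expRD expRN lnK ?posrE// mulrCA divff ?gt_eqF// mulr1.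
    rewrite /powR gt_eqF// -expRD; congr expR; ring.
  + by apply/measurable_EFinP; exact: measurable_cos_kernel.
  + by move=> s _; rewrite lee_fin cos_kernel_ge0.
- exact: continuous_cos_kernel.
- exact: cos_kernel_ge0.
Qed.

(** The constant is finite: 1 - cos(e^s) <= 2 controls s >= 0, which uses r > 0,
    and 1 - cos(e^s) <= e^(2s)/2 controls s <= 0, which uses r < 2.  Both bounds
    are multiples of (reflected) exponential densities. *)
Lemma cos_kernel_integral_fin r : (0 < r < 2)%R ->
  \int[leb]_s (cos_kernel r 1 s)%:E < +oo.
Proof.
move=> /andP[r0 r2].
have r2' : (0 < 2 - r)%R by rewrite subr_gt0.
pose b s : R := (2 / r * exponential_pdf r s +
  (2 - r)^-1 * exponential_pdf (2 - r) (- s))%R.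
have mp q : measurable_fun setT (@exponential_pdf R q) by exact: measurable_exponential_pdf.
have mpN q : measurable_fun setT (fun s => @exponential_pdf R q (- s)%R).
  exact: measurableT_comp.
have p0 q s : (0 < q)%R -> (0 <= @exponential_pdf R q s)%R.
  by move=> q0; apply: exponential_pdf_ge0; exact: ltW.
apply: (@le_lt_trans _ _ (\int[leb]_s (b s)%:E)).
  apply: ge0_le_integral => //.
  - by move=> s _; rewrite lee_fin cos_kernel_ge0.
  - by apply/measurable_EFinP; exact: measurable_cos_kernel.
  - apply/measurable_EFinP; apply: measurable_funD; apply: measurable_funM => //; [exact: mp|exact: mpN].
  - move=> s _; rewrite lee_fin /b /cos_kernel mul1r.
    have [s0|s0] := leP 0%R s.
      rewrite -[leLHS]addr0 lerD//; last first.
        by rewrite mulr_ge0 ?p0// invr_ge0 ltW.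
      rewrite exponential_pdfE// mulrA divfK ?gt_eqF//.
      by rewrite ler_wpM2r ?expR_ge0// oneBcos_le2.
    rewrite -[leLHS]add0r lerD//.
      by rewrite mulr_ge0 ?p0// divr_ge0 // ltW.
    rewrite exponential_pdfE ?oppr_ge0 ?(ltW s0)// mulrA mulVf ?gt_eqF// mul1r.
    have -> : (- (2 - r) * - s = s + s + - r * s)%R by ring.
    rewrite 2!expRD ler_wpM2r ?expR_ge0// (le_trans (oneBcos_le _))//.
    by rewrite ler_pdivrMr// expr2 ler_peMr ?mulr_ge0 ?expR_ge0// ler1n.
rewrite /b; under eq_integral do rewrite EFinD !EFinM.
have i0 q c : (0 < q)%R -> (0 <= c)%R ->
    \int[leb]_s (c%:E * (exponential_pdf q s)%:E) = c%:E.
  move=> q0 c0; rewrite ge0_integralZl//.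
  - by rewrite integral_exponential_pdf// mule1.
  - by apply/measurable_EFinP; exact: mp.
  - by move=> s _; rewrite lee_fin p0.
rewrite ge0_integralD//; last 4 first.
- by move=> s _; rewrite mule_ge0// ?lee_fin ?p0// divr_ge0// ltW.
- by apply: emeasurable_funM => //; apply/measurable_EFinP; exact: mp.
- by move=> s _; rewrite mule_ge0// ?lee_fin ?p0// invr_ge0 ltW.
- by apply: emeasurable_funM => //; apply/measurable_EFinP; exact: mpN.
under [X in _ + X]eq_integral do rewrite -EFinM.
rewrite (integral_reflect (fun s => (2 - r)^-1 * exponential_pdf (2 - r) s)%R); last 2 first.
- exact: measurable_funM.
- by move=> s; rewrite mulr_ge0 ?p0// invr_ge0 ltW.
under [X in _ + X]eq_integral do rewrite EFinM.
by rewrite !i0 ?ltry ?invr_ge0 ?divr_ge0 ?ltW.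
Qed.

(** It is positive since the kernel is bounded below by 1 - cos(1/e) on [-1, 0]. *)
Lemma cos_kernel_integral_gt0 r : (0 < r)%R ->
  0 < \int[leb]_s (cos_kernel r 1 s)%:E.
Proof.
move=> r0.
pose c : R := (1 - cos (expR (-1)))%R.
have e1 : (expR (-1) < 1 :> R)%R by rewrite expR_lt1 ltrN10.
have c0 : (0 < c)%R.
  rewrite subr_gt0 -[ltRHS](cos0 R) ltr_cos ?in_itv/= ?expR_gt0 ?expR_ge0 ?lexx ?pi_ge0//.
  by rewrite (le_trans (ltW e1))// (le_trans _ (pi_ge2 _))// ler1n.
apply: (@lt_le_trans _ _ (\int[leb]_(s in `[(-1)%R, 0%R]) c%:E)).
  rewrite integral_cst//= lebesgue_measure_itv/= lte_fin ltrN10.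
  by rewrite -EFinB sub0r opprK mule1 lte_fin.
apply: (@le_trans _ _ (\int[leb]_(s in `[(-1)%R, 0%R]) (cos_kernel r 1 s)%:E)).
  apply: ge0_le_integral => //.
  - by move=> s _; rewrite lee_fin ltW.
  - by apply/measurable_EFinP/measurable_funTS; exact: measurable_cos_kernel.
  - move=> s; rewrite /= in_itv/= => /andP[s1 s0]; rewrite lee_fin /cos_kernel mul1r.
    rewrite -[c]mulr1 ler_pM ?(ltW c0)//; last first.
      by rewrite -expR0 ler_expR mulNr oppr_ge0 mulr_ge0_le0// ltW.
    have e1' : (expR s <= 1)%R by rewrite -expR0 ler_expR.
    rewrite /c lerD2l lerN2; case: (ltgtP (-1)%R s) s1 => // [s1 _|<- //].
    apply/ltW; rewrite ltr_cos ?ltr_expR// in_itv/= expR_ge0/=.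
      by rewrite (le_trans (ltW e1))// (le_trans _ (pi_ge2 _))// ler1n.
    by rewrite (le_trans e1')// (le_trans _ (pi_ge2 _))// ler1n.
apply: ge0_subset_integral => //.
- by apply/measurable_EFinP; exact: measurable_cos_kernel.
- by move=> s _; rewrite lee_fin cos_kernel_ge0.
Qed.

End Kernel.

(** * The moment inequality for exponents at most 2 *)

Section Moments.
Context (R : realType) (d : measure_display) (T : measurableType d)
  (P : probability T R).
Local Notation leb := (@lebesgue_measure R).
Local Open Scope ereal_scope.

Let measurable_cosM t : measurable_fun setT (fun x : R => 1 - cos (x * t))%R.
Proof.
apply: measurable_funB => //.
apply: (measurableT_comp (continuous_measurable_fun (@continuous_cos R))).
exact: measurable_funM.
Qed.

(** The two sides differ by 2 E sin(Xt) sin(Yt). *)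
Lemma expectation_oneBcos_le (X Y : {RV P >-> R}) t :
  bounded_nonneg_definite R d T P X Y ->
  \int[P]_w (1 - cos ((X w - Y w) * t))%:E <=
  \int[P]_w (1 - cos ((X w + Y w) * t))%:E.
Proof.
move=> psd; pose delta x : R := sin (x * t).
have mdelta : measurable_fun setT delta.
  apply: (measurableT_comp (continuous_measurable_fun (@continuous_sin R))).
  exact: measurable_funM.
have := psd _ mdelta (fun x => sin_max _).
have E w : (1 - cos ((X w + Y w) * t) =
    1 - cos ((X w - Y w) * t) + 2 * (delta (X w) * delta (Y w)))%R.
  by rewrite mulrDl mulrBl cosD cosB /delta; ring.
have mdd : measurable_fun setT (fun w => delta (X w) * delta (Y w))%R.
  by apply: measurable_funM; apply: measurableT_comp.
have idd : P.-integrable setT (fun w => (delta (X w) * delta (Y w))%:E).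
  by apply: (bounded_integrable _ _ _ _ _ 1%R) => // w; rewrite normrM mulr_ile1// sin_max.
have mB : measurable_fun setT (fun w => X w - Y w)%R by exact: measurable_funB.
have ic : P.-integrable setT (fun w => (1 - cos ((X w - Y w) * t))%:E).
  apply: (bounded_integrable _ _ _ _ (fun w => 1 - cos ((X w - Y w) * t))%R 2%R) => [|w].
    exact: (measurableT_comp (measurable_cosM t)).
  by rewrite ger0_norm ?oneBcos_ge0 ?oneBcos_le2.
move=> dd0.
under [leRHS]eq_integral => w _ do rewrite E EFinD EFinM.
rewrite integralD//; last exact: integrableZl.
by rewrite integralZl// leeDl// mule_ge0.
Qed.

Lemma measurable_cos_kernel2 (Z : T -> R) r : measurable_fun setT Z ->
  measurable_fun setT
    (fun x : T * measurableTypeR R => (cos_kernel r (Z x.1) x.2)%:E).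
Proof.
move=> mZ; have mexp : measurable_fun setT (@expR R : measurableTypeR R -> R).
  exact: measurable_expR.
have msnd : measurable_fun setT (snd : T * measurableTypeR R -> measurableTypeR R).
  exact: measurable_snd.
apply/measurable_EFinP; apply: measurable_funM.
  apply: measurable_funB => //.
  apply: (measurableT_comp (continuous_measurable_fun (@continuous_cos R))).
  apply: measurable_funM; first exact: (measurableT_comp mZ measurable_fst).
  exact: (measurableT_comp mexp msnd).
apply: (measurableT_comp mexp).
by apply: measurable_funM.
Qed.

(** The Tonelli step: E|Z|^r is, up to the constant, a mixture of the numbers
    E(1 - cos(Z e^s)). *)
Lemma expectation_powR_cos_kernel (Z : T -> R) (r : R) : (0 < r)%R ->
  measurable_fun setT Z ->
  \int[P]_w (`|Z w| `^ r)%:E * \int[leb]_s (cos_kernel r 1 s)%:E =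
  \int[leb]_s \int[P]_w (cos_kernel r (Z w) s)%:E.
Proof.
move=> r0 mZ.
have K0 : 0 <= \int[leb]_s (cos_kernel r 1 s)%:E.
  by apply: integral_ge0 => s _; rewrite lee_fin cos_kernel_ge0.
rewrite -ge0_integralZr//; last first.
  by apply/measurable_EFinP; apply: (measurableT_comp (measurable_powR _)); exact: measurableT_comp.
under eq_integral do rewrite -integral_cos_kernel_scale//.
apply: (@fubini_tonelli _ _ T (measurableTypeR R) R P leb
  (fun x => (cos_kernel r (Z x.1) x.2)%:E)).
  exact: measurable_cos_kernel2.
by move=> x; rewrite lee_fin cos_kernel_ge0.
Qed.

Lemma expectation_powR_le (X Y : {RV P >-> R}) r :
  bounded_nonneg_definite R d T P X Y -> (0 < r <= 2)%R ->
  \int[P]_w (`|X w - Y w| `^ r)%:E <= \int[P]_w (`|X w + Y w| `^ r)%:E.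
Proof.
have measurableD_XY : measurable_fun setT (fun w => X w + Y w)%R.
  exact: measurable_funD.
have measurableB_XY : measurable_fun setT (fun w => X w - Y w)%R.
  exact: measurable_funB.
move=> psd /andP[r0]; rewrite le_eqVlt => /predU1P[->|r2].
  have powR2E (x : R) : (`|x| `^ 2 = x ^+ 2)%R.
    by rewrite (powR_mulrn 2)// real_normK ?num_real.
  under eq_integral do rewrite powR2E.
  under [leRHS]eq_integral do rewrite powR2E.
  (* the critical exponent: u n x tends to x ^ 2, which Fatou's lemma
     uses on the left, and u n x <= x ^ 2 bounds the right-hand side *)
  pose u n (x : R) : R := (2 * (n.+1%:R ^+ 2 * (1 - cos (x / n.+1%:R))))%R.
  have u0 n x : (0 <= u n x)%R by rewrite !mulr_ge0// oneBcos_ge0.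
  have mu (Z : T -> R) n : measurable_fun setT Z ->
      measurable_fun setT (fun w => (u n (Z w))%:E).
    move=> mZ; apply/measurable_EFinP; do 2 apply: measurable_funM => //.
    exact: (measurableT_comp (measurable_cosM _)).
  have umono n : \int[P]_w (u n (X w - Y w))%:E <= \int[P]_w (u n (X w + Y w))%:E.
    have uE (Z : T -> R) : measurable_fun setT Z -> \int[P]_w (u n (Z w))%:E =
        (2 * n.+1%:R ^+ 2)%:E * \int[P]_w (1 - cos (Z w / n.+1%:R))%:E.
      move=> mZ; under eq_integral do rewrite /u mulrA EFinM.
      rewrite ge0_integralZl ?lee_fin ?mulr_ge0//.
      by apply/measurable_EFinP; exact: (measurableT_comp (measurable_cosM _)).
    by rewrite !uE// lee_wpmul2l ?lee_fin ?mulr_ge0// expectation_oneBcos_le.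
  have u_le n x : (u n x <= x ^+ 2)%R.
    have n0 : (n.+1%:R != 0 :> R)%R by rewrite pnatr_eq0.
    have := oneBcos_le (x / n.+1%:R).
    rewrite /u; move: (1 - _)%R => c cle.
    have -> : (x ^+ 2 = 2 * (n.+1%:R ^+ 2 * ((x / n.+1%:R) ^+ 2 / 2)))%R by field.
    by rewrite !ler_wpM2l.
  have cvgu x : (u n x)%:E @[n --> \oo] --> (x ^+ 2)%:E.
    apply: cvg_EFin; first exact: nearW.
    rewrite (_ : (x ^+ 2 = 2 * (x ^+ 2 / 2))%R); last by field.
    by apply: cvgMr; exact: cvg_oneBcos.
  have -> : \int[P]_w ((X w - Y w) ^+ 2)%:E =
      \int[P]_w limn_einf (fun n => (u n (X w - Y w))%:E).
    by apply: eq_integral => w _; rewrite (cvg_limn_einf_sup (cvgu _)).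
  apply: (le_trans (fatou _ _ _ _)) => //.
  - by move=> n; exact: mu.
  - by move=> n w _; rewrite lee_fin.
  rewrite limn_einf_lim; apply: lime_le; first exact: is_cvg_einfs.
  apply: nearW => n; apply: (@le_trans _ _ (\int[P]_w (u n (X w - Y w))%:E)).
    by apply: ereal_inf_lbound; exists n => //=.
  apply: (le_trans (umono n)); apply: ge0_le_integral => //.
  - by move=> w _; rewrite lee_fin.
  - exact: mu.
  - by apply/measurable_EFinP; exact: measurable_funX.
  - by move=> w _; rewrite lee_fin.
pose K := \int[leb]_s (cos_kernel r 1 s)%:E.
have K0 : 0 < K by exact: cos_kernel_integral_gt0.
have Kfin : K \is a fin_num.
  by rewrite ge0_fin_numE ?(ltW K0)// cos_kernel_integral_fin// r0.
suff : \int[P]_w (`|X w - Y w| `^ r)%:E * K <= \int[P]_w (`|X w + Y w| `^ r)%:E * K.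
  by rewrite lee_pmul2r.
rewrite !expectation_powR_cos_kernel//.
apply: ge0_le_integral => //.
- by move=> s _; apply: integral_ge0 => w _; rewrite lee_fin cos_kernel_ge0.
- exact: (measurable_fun_fubini_tonelli_G _ (measurable_cos_kernel2 _ r measurableB_XY)
    (fun x => cos_kernel_ge0 _ _ _)).
- exact: (measurable_fun_fubini_tonelli_G _ (measurable_cos_kernel2 _ r measurableD_XY)
    (fun x => cos_kernel_ge0 _ _ _)).
- move=> s _; rewrite /cos_kernel.
  under eq_integral do rewrite EFinM.
  under [leRHS]eq_integral do rewrite EFinM.
  rewrite !ge0_integralZr ?lee_fin ?expR_ge0//.
  + by rewrite lee_wpmul2r ?lee_fin ?expR_ge0// expectation_oneBcos_le.
  + by apply/measurable_EFinP; exact: (measurableT_comp (measurable_cosM _)).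
  + by apply/measurable_EFinP; exact: (measurableT_comp (measurable_cosM _)).
Qed.

End Moments.

(** * A counterexample for exponents above 2 *)

Section Counterexample.
Context {R : realType}.
Implicit Types r th : R.

(** Since 17/16 > 1 > 15/16, passing from exponent 2 to r only increases the gap
    between the two powers, which is 1/4 at exponent 2, while 2^(-r) drops
    below 1/4. *)
Lemma powR_gap r : 2 < r ->
  2^-1 `^ r + (15 / 16) `^ r < (17 / 16) `^ r :> R.
Proof.
move=> r2; have [s s0 ->] : exists2 s, 0 < s & r = 2 + s.
  by exists (r - 2); [rewrite subr_gt0|rewrite addrC subrK].
rewrite !powRD; try by rewrite implybE; apply/orP; right; lra.
rewrite !powRr1; try lra.
have p1 : 1 `^ s = 1 :> R by rewrite powR1.
have : 2^-1 `^ s < (1 : R).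
  rewrite -[ltRHS]p1 gt0_ltr_powR// ?nnegrE; lra.
have : (15 / 16) `^ s <= (1 : R).
  rewrite -[leRHS]p1 ge0_ler_powR ?nnegrE ?(ltW s0)//; lra.
have : (1 : R) <= (17 / 16) `^ s.
  rewrite -[leLHS]p1 ge0_ler_powR ?nnegrE ?(ltW s0)//; lra.
move: (_ `^ _) (_ `^ _) (_ `^ _) => A B C; lra.
Qed.

Definition twopoint_val (b : bool) : R := if b then 1 else - 16^-1.

Definition iid_bernoulli th : probability (bool * bool)%type R :=
  (bernoulli_prob th \x bernoulli_prob th)%E.

Lemma measurable_bool2 (f : bool * bool -> R) : measurable_fun setT f.
Proof.
rewrite (_ : f = fun z => if z.1 then (if z.2 then f (true, true) else f (true, false))
   else (if z.2 then f (false, true) else f (false, false))); last first.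
  by apply/funext => -[[] []].
have m1 : measurable_fun setT (fst : bool * bool -> bool) by exact: measurable_fst.
have m2 : measurable_fun setT (snd : bool * bool -> bool) by exact: measurable_snd.
by apply: measurable_fun_ifT => //; apply: measurable_fun_ifT.
Qed.

Definition RV_bool2 th (f : bool * bool -> R) : {RV (iid_bernoulli th) >-> R} :=
  HB.pack_for {mfun (bool * bool)%type >-> R} f
    (isMeasurableFun.Build _ _ _ _ f (measurable_bool2 f)).

Local Open Scope ereal_scope.

Lemma expectation_iid_bernoulli th (f : bool * bool -> R) : (0 <= th <= 1)%R ->
  (forall z, 0 <= f z)%R ->
  'E_(iid_bernoulli th)[f] =
  (th * (th * f (true, true) + (1 - th) * f (true, false)) +
   (1 - th) * (th * f (false, true) + (1 - th) * f (false, false)))%:E.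
Proof.
move=> th01 f0; rewrite unlock.
rewrite [LHS](fubini_tonelli1 (EFin \o f))//=; last first.
  by apply/measurable_EFinP; exact: measurable_bool2.
rewrite integral_bernoulli_prob//; last first.
  by move=> x; apply: integral_ge0 => y _; rewrite lee_fin.
by rewrite /fubini_F/= !integral_bernoulli_prob// => x; rewrite lee_fin.
Qed.

Definition RVX th : {RV (iid_bernoulli th) >-> R} :=
  RV_bool2 th (fun z => twopoint_val z.1).
Definition RVY th : {RV (iid_bernoulli th) >-> R} :=
  RV_bool2 th (fun z => twopoint_val z.2).

(** Independence makes the array a product [w i * w j], whose quadratic form is
    a square. *)
Lemma discrete_model_iid_bernoulli th : (0 <= th <= 1)%R ->
  discrete_model (iid_bernoulli th) (RVX th) (RVY th).
Proof.
move=> th01; have /andP[th0 th1] := th01.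
pose b i : bool := (i == 0)%N.
pose w i : R := if b i then th else (1 - th)%R.
have w0 i : (0 <= w i)%R by rewrite /w; case: ifP; rewrite ?subr_ge0.
have tv_inj : injective twopoint_val by move=> [] []//; rewrite /twopoint_val; lra.
exists `I_2, (fun i => twopoint_val (b i)), (fun i j => w i * w j)%R; split; first split.
- by left; exists 2%N.
- by move=> [|[|i]] [|[|j]] // _ _ e; have := tv_inj _ _ e.
- by move=> i j _ _; rewrite mulrC.
- by move=> i j _ _; rewrite mulr_ge0.
- under eq_esum => i _.
    rewrite esum_fset//=; last by move=> j _; rewrite lee_fin mulr_ge0.
    rewrite -fsbig_ord/= sumEFin 2!big_ord_recl big_ord0.
    over.
  rewrite esum_fset//=; last by move=> j _; rewrite lee_fin !addr_ge0 ?mulr_ge0.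
  by rewrite -fsbig_ord/= sumEFin 2!big_ord_recl big_ord0 /w/=; congr EFin; ring.
- move=> F u _; rewrite (_ : (\sum_(i <- F) _ = (\sum_(i <- F) u i * w i) ^+ 2)%R) ?sqr_ge0//.
  rewrite expr2 big_distrlr/=; apply: eq_bigr => i _; apply: eq_bigr => j _; ring.
- move=> i j _ _.
  have Qb k : bernoulli_prob th [set b k] = (w k)%:E.
    have mem1 (x y : bool) : (x \in [set y]) = (x == y).
      by apply/idP/eqP => [/[!inE]//|->]; rewrite inE.
    rewrite bernoulli_probE// /w !diracE !mem1.
    by case: (b k) => /=; rewrite ?mule1 ?mule0 ?adde0 ?add0e.
  rewrite (_ : [set _ | _] = [set b i] `*` [set b j]).
    transitivity (bernoulli_prob th [set b i] * bernoulli_prob th [set b j]).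
      exact: product_measure1E.
    by rewrite !Qb.
  apply/seteqP; split => [[x y] /= [/tv_inj -> /tv_inj ->]//|[x y] /= [-> ->]//].
Qed.

(** With q = 4^(-r), the difference of the two sides is 2 q / (1 + q)^2 times the
    difference in [powR_gap]. *)
Lemma counterexample r : (2 < r)%R ->
  exists2 th, (0 <= th <= 1)%R &
    'E_(iid_bernoulli th)[(fun z => `|RVX th z + RVY th z| `^ r)%R] <
    'E_(iid_bernoulli th)[(fun z => `|RVX th z - RVY th z| `^ r)%R].
Proof.
move=> r2; have gap := powR_gap _ r2.
pose h := (2^-1 `^ r : R)%R.
have h0 : (0 < h)%R by rewrite powR_gt0// invr_gt0.
pose q : R := (h ^+ 2)%R.
have q0 : (0 < q)%R by rewrite exprn_gt0.
(* odds q : 1 with q = b^(r/2) for b = 1/16 *)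
exists (q / (1 + q))%R; first by rewrite divr_ge0 ?ler_pdivrMr/=; lra.
rewrite !expectation_iid_bernoulli; try (by move=> z; exact: powR_ge0); try (by
  rewrite divr_ge0 ?ler_pdivrMr/=; lra).
rewrite lte_fin /= /twopoint_val.
have -> : (`|1 + 1| = 2 :> R)%R by rewrite ger0_norm; lra.
have -> : (`|1 - 16^-1| = 15 / 16 :> R)%R by rewrite ger0_norm; lra.
have -> : (`|- 16^-1 + 1| = 15 / 16 :> R)%R by rewrite ger0_norm; lra.
have -> : (`|- 16^-1 - 16^-1| = 2^-1 * (2^-1 * 2^-1) :> R)%R.
  by rewrite ler0_norm; lra.
have -> : (`|1 - - 16^-1| = 17 / 16 :> R)%R by rewrite ger0_norm; lra.
have -> : (`|- 16^-1 - 1| = 17 / 16 :> R)%R by rewrite ler0_norm; lra.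
move: gap; rewrite -/h.
move: ((15 / 16) `^ r)%R ((17 / 16) `^ r)%R => A B gap.
rewrite !subrr normr0 powR0 ?gt_eqF ?(lt_trans _ r2)// !powRM ?mulr_ge0 ?invr_ge0//.
rewrite -/h.
have -> : (2 `^ r = h^-1)%R.
  apply: (mulfI (lt0r_neq0 h0)); rewrite divff ?lt0r_neq0//.
  by rewrite /h -powRM ?invr_ge0// mulVf ?powR1.
rewrite -subr_gt0 [ltRHS](_ : _ = (2 * q / (1 + q) ^+ 2 * (B - (h + A))))%R.
  by rewrite !mulr_gt0 ?subr_gt0// ?exprn_gt0 ?invr_gt0 ?exprn_gt0// addr_gt0.
have q1 : (1 + h ^+ 2 != 0)%R by rewrite lt0r_neq0// addr_gt0.
by rewrite /q; field; rewrite q1 lt0r_neq0.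
Qed.

End Counterexample.

Theorem theorem3 (R : realType) (r : R) (r_gt0 : 0 < r) :
  (forall (d : measure_display) (T : measurableType d) (P : probability T R)
      (X Y : {RV P >-> R}),
    discrete_model P X Y \/ density_model P X Y ->
    ('E_P[(fun w => `|X w| `^ r)%R] < +oo)%E ->
    ('E_P[(fun w => `|X w + Y w| `^ r)%R] >=
     'E_P[(fun w => `|X w - Y w| `^ r)%R])%E)
  <-> 0 < r <= 2.
Proof.
split=> [H|r02 d T P X Y model _].
  rewrite r_gt0 leNgt; apply/negP => /counterexample[th th01].
  rewrite ltNge => /negP; apply; apply: H.
    by left; exact: discrete_model_iid_bernoulli.
  by rewrite expectation_iid_bernoulli ?ltry// => z; exact: powR_ge0.
rewrite unlock; apply: expectation_powR_le => //.
by case: model => [/discrete_bounded_ge0|/density_bounded_ge0].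
Qed.
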